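(* Let $\mathcal{A}=(V,V_P,E,T)$ be a target arena, $W\subseteq V$ a non-empty set of vertices and $v\in V$. The following are equivalent: (i) $v\unlhd W$ does not hold; (ii) there exist a drift partition $(S_i)_{0\le i\le k}$ of $V$ and a simple path $\pi$ in $(V,E)$ starting in $v$ and ending in a vertex of $T$ such that every vertex of $\pi$ lies in $S_k$ and $W\subseteq S_k^-$.
   Context: A target arena is a tuple $\mathcal{A}=(V,V_P,E,T)$ where $V$ is finite, $V_P\subseteq V$, $V_N:=V\setminus V_P$, $E\subseteq (V_P\times V_N)\cup(V_N\times V_P)$, $T\subseteq V_P$, and $uE:=\{v\mid (u,v)\in E\}\neq\emptyset$ for all $u\in V_N$. A family of full-support probability distributions is $\mu=(\mu_u)_{u\in V_N}$ with each $\mu_u:uE\to\mathbb{Q}_{>0}$ summing to $1$. A strategy is a function $\sigma:V_P\to V_N$. The arena, $\mu$ and $\sigma$ induce the Markov chain on $V_P\cup\{\bot\}$ in which from $p\in V_P$ the next state is $q$ with probability $\mu_{\sigma(p)}(q)$ if $(p,\sigma(p))\in E$, and $\bot$ with probability $1$ otherwise; $\bot$ is absorbing. $\mathrm{Val}^\mu(v):=\max_\sigma$ (probability of eventually reaching $T$ from $v$ in this chain) for $v\in V_P$, and $\mathrm{Val}^\mu(u):=\sum_{v\in uE}\mu_u(v)\mathrm{Val}^\mu(v)$ for $u\in V_N$. For $v\in V$, $W\subseteq V$: $v\unlhd W$ iff for every full-support family $\mu$ there exists $w\in W$ with $\mathrm{Val}^\mu(v)\le\mathrm{Val}^\mu(w)$.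 Drift partition: given a partition $(S_i)_{0\le i\le k}$ of $V$, let $S_i^+:=\bigcup_{i<j\le k}S_j$, $S_i^-:=\bigcup_{j<i}S_j$, $D_i:=\{u\in S_i\cap V_N\mid uE\cap S_i^-\neq\emptyset\}$ and $D:=\bigcup_{0<i<k}D_i$ (the drift vertices). The partition is a drift partition if (a) for all $i\le k$ and all $u\in S_i\cap V_P$, $uE\cap S_i^+=\emptyset$; and (b) for all $i\le k$ and all $u\in S_i\cap V_N$, if $uE\cap S_i^+\neq\emptyset$ then $u\in D$.
   Formalization: Condition (ii) additionally requires T ⊆ S_k (automatic when T has at most one element); without it (ii) does not imply (i), e.g. when v and w are distinct targets, W = {w}, and w is placed in a lower class. *)

(* Defs.v *)
From HB Require Import structures.
From mathcomp Require Import all_boot all_order all_algebra.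
From mathcomp Require Import all_classical all_reals all_analysis.

Set Implicit Arguments.
Unset Strict Implicit.
Unset Printing Implicit Defensive.

Import Order.TTheory GRing.Theory Num.Theory.
Import numFieldNormedType.Exports.

Local Open Scope ring_scope.

(* V_N is the complement of [protagonist]; [v \in uE] is [edge u v]. *)
Record target_arena (V : finType) := TargetArena {
  protagonist : {set V};
  edge : rel V;
  target : {set V};
  edge_bipartite : forall u v, edge u v ->
    (u \in protagonist) && (v \notin protagonist)
    || (u \notin protagonist) && (v \in protagonist);
  target_sub : target \subset protagonist;
  nature_succ : forall u, u \notin protagonist -> exists v, edge u v
}.

Section Values.
Variables (V : finType) (A : target_arena V).

Definition pvertex : finType := {p : V | p \in protagonist A}.
Definition nvertex : finType := {u : V | u \notin protagonist A}.

(* mu_u is extended by 0 outside uE; [mu u] is irrelevant for u in V_P. *)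
Definition full_support (mu : V -> V -> rat) : Prop :=
  forall u, u \notin protagonist A ->
    [/\ forall v, edge A u v -> 0 < mu u v,
        forall v, ~~ edge A u v -> mu u v = 0
      & \sum_(v | edge A u v) mu u v = 1].

Definition strategy : finType := {ffun pvertex -> nvertex}.

(* [None] is the absorbing state bot. *)
Definition state : finType := option pvertex.

Definition step (mu : V -> V -> rat) (s : strategy) (x y : state) : rat :=
  match x with
  | Some p =>
      if edge A (val p) (val (s p)) then
        if y is Some q then mu (val (s p)) (val q) else 0
      else (y == None)%:R
  | None => (y == None)%:R
  end.

Fixpoint path_prob (mu : V -> V -> rat) (s : strategy) (x : state)
    (h : seq state) : rat :=
  if h is y :: h' then step mu s x y * path_prob mu s y h' else 1.

Definition in_target (x : state) : bool :=
  if x is Some p then val p \in target A else false.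

(* The law of the first n steps of the chain from p, evaluated on the event
   that one of the n + 1 states visited is in T. *)
Definition reach_within (mu : V -> V -> rat) (s : strategy) (p : pvertex)
    (n : nat) : rat :=
  \sum_(h : n.-tuple state | has in_target (Some p :: h))
     path_prob mu s (Some p) h.

(* The event "eventually T" is the increasing union of the events
   "T within n steps". *)
Definition reach_prob (R : realType) (mu : V -> V -> rat) (s : strategy)
    (p : pvertex) : R :=
  limn (fun n => ratr (reach_within mu s p n) : R).

(* The initial value of the maximum never exceeds [reach_prob]: it only matters
   when V_N is empty, where there is no strategy (and no edge) and the
   probability of reaching T from p is 1 or 0 according to whether p is in T. *)
Definition valueP (R : realType) (mu : V -> V -> rat) (p : pvertex) : R :=
  \big[Num.max/(val p \in target A)%:R]_(s : strategy) reach_prob R mu s p.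

(* Val; by bipartiteness every successor of a vertex of V_N is in V_P, so the
   default of the inner [if] is never used. *)
Definition value (R : realType) (mu : V -> V -> rat) (v : V) : R :=
  if insub v is Some p then valueP R mu p
  else \sum_(w | edge A v w)
         ratr (mu v w) * (if insub w is Some q then valueP R mu q else 0).

Definition never_worse (R : realType) (v : V) (W : {set V}) : Prop :=
  forall mu, full_support mu ->
    exists2 w, w \in W & value R mu v <= value R mu w.

End Values.

Section Drift.
Variables (V : finType) (A : target_arena V) (k : nat).
Variable S : 'I_k.+1 -> {set V}.

Definition indexed_partition : Prop :=
  [/\ forall i, S i != finset.set0,
      forall i j, i != j -> [disjoint S i & S j]
    & (\bigcup_i S i)%SET = [set: V]%SET].

Definition above (i : 'I_k.+1) : {set V} := (\bigcup_(j : 'I_k.+1 | (i < j)%N) S j)%SET.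
Definition below (i : 'I_k.+1) : {set V} := (\bigcup_(j : 'I_k.+1 | (j < i)%N) S j)%SET.

Definition drift_at (i : 'I_k.+1) : {set V} :=
  [set u in S i | (u \notin protagonist A)
                  && [exists v, edge A u v && (v \in below i)]]%SET.

Definition drift : {set V} :=
  (\bigcup_(i : 'I_k.+1 | (0 < i < k)%N) drift_at i)%SET.

Definition drift_partition : Prop :=
  [/\ indexed_partition,
      forall (i : 'I_k.+1) u v, u \in S i -> u \in protagonist A ->
        edge A u v -> v \notin above i
    & forall (i : 'I_k.+1) u v, u \in S i -> u \notin protagonist A ->
        edge A u v -> v \in above i -> u \in drift].

End Drift.

(* Main.v *)
(**
  Everything follows from four properties of the value function [f]: it is
  [1] on targets, the [mu]-average of its successors at a vertex of V_N,
  at least the value of each successor at a vertex of V_P, and it lies below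
  every nonnegative function that is at least [1] on targets, dominates its
  successors on V_P and its [mu]-averages on V_N.  The third property needs
  one strategy that is optimal from all vertices simultaneously; a strategy
  maximizing the sum of all reachability probabilities is one, since switching
  it at a single vertex cannot improve it.

  Given [mu] separating [v] from [W], the level sets of [f] below [f v],
  topped by [{f >= f v}], form a drift partition.

  Conversely, let every drift vertex move to a lower level, and every vertex
  of V_N on the path move along the path, with probability at least [1 - e].
  Then [f v >= (1 - e) ^ |pi|], while a vertex of level [i < k] has value at
  most [1 - (1 - e) ^ i], which is smaller once [(|pi| + k) e < 1].
*)
Require Import Defs.
From HB Require Import structures.
From mathcomp Require Import all_boot all_order all_algebra.
From mathcomp Require Import all_classical all_reals all_analysis.
From mathcomp Require Import ring lra.

Set Implicit Arguments.
Unset Strict Implicit.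
Unset Printing Implicit Defensive.

Import Order.TTheory GRing.Theory Num.Theory.
Import numFieldNormedType.Exports.

Local Open Scope classical_set_scope.
Local Open Scope ring_scope.

(** * Sums over tuples and over option types *)

Lemma big_tuple_cons (M : nmodType) (T : finType) (n : nat)
    (P : pred (n.+1.-tuple T)) (F : n.+1.-tuple T -> M) :
  \sum_(t | P t) F t =
  \sum_(x : T) \sum_(t : n.-tuple T | P (cons_tuple x t)) F (cons_tuple x t).
Proof.
rewrite pair_big_dep /=.
rewrite (reindex (fun p : T * n.-tuple T => cons_tuple p.1 p.2)) //=.
exists (fun t => (thead t, [tuple of behead t])) => [[x t] _ | t _].
  by congr pair; apply: val_inj.
by rewrite [RHS]tuple_eta; apply: val_inj.
Qed.

Lemma sum_option (M : nmodType) (T : finType) (F : option T -> M) :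
  \sum_x F x = F None + \sum_x F (Some x).
Proof.
rewrite (bigD1 None) //=; congr (_ + _).
rewrite (reindex_omap Some id) //; last by case.
by apply: eq_bigl => x; rewrite eqxx.
Qed.

Lemma ltr_sum_le (N : numDomainType) (I : finType) (F G : I -> N) (j : I) :
  (forall i, F i <= G i) -> F j < G j -> \sum_i F i < \sum_i G i.
Proof.
move=> leFG ltFG; rewrite (bigD1 j) //= [ltRHS](bigD1 j) //=.
by apply: ltr_leD => //; apply: ler_sum.
Qed.

(** * The Markov chain of a fixed strategy and its reachability probabilities *)

Section Chain.
Variables (R : realType) (V : finType) (A : target_arena V).
Variable mu : V -> V -> rat.
Hypothesis mu_full : full_support A mu.

Local Notation state := (state A).
Local Notation strategy := (strategy A).
Local Notation pvertex := (pvertex A).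
Local Notation nvertex := (nvertex A).
Implicit Types (s : strategy) (x y : state) (p q : pvertex).

Lemma mu_ge0 u w : u \notin protagonist A -> 0 <= mu u w.
Proof.
move=> /mu_full[mu_gt0 mu_0 _].
by have [/mu_gt0/ltW|/mu_0->] := boolP (edge A u w).
Qed.

(** The chain sums over [pvertex], the value function over [uE]. By bipartiteness [uE] consists of
    protagonist vertices, and [mu u] vanishes off [uE]. The morphism [f] serves both [rat] itself
    and [ratr]. *)
Lemma sum_mu_pvertex (M : pzRingType) (f : {rmorphism rat -> M}) (F : V -> M) u :
  u \notin protagonist A ->
  \sum_(q : pvertex) f (mu u (val q)) * F (val q) =
  \sum_(w | edge A u w) f (mu u w) * F w.
Proof.
move=> uN; have [_ mu_0 _] := mu_full uN.
rewrite -(big_sub (fun w => w \in protagonist A) (fun w => f (mu u w) * F w)).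
rewrite [LHS]big_mkcond [RHS]big_mkcond; apply: eq_bigr => w _.
case: ifPn => wP; case: ifPn => // uw.
  by rewrite mu_0 // rmorph0 mul0r.
by move: (edge_bipartite uw) uN wP; rewrite unfold_in => /orP[]/andP[] => [-> | _ ->].
Qed.

Lemma step_ge0 s x y : 0 <= step mu s x y.
Proof.
case: x => [p|] /=; last exact: ler0n.
case: ifP => _; last exact: ler0n.
by case: y => // q; apply: mu_ge0; exact: (valP (s p)).
Qed.

Lemma step_sum1 s x : \sum_y step mu s x y = 1.
Proof.
case: x => [p|] /=; last first.
  by rewrite sum_option eqxx big1 ?addr0.
case: (edge A (val p) (val (s p))); last by rewrite sum_option eqxx big1 ?addr0.
rewrite sum_option add0r.
have /= uN := valP (s p); have [_ _ <-] := mu_full uN.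
transitivity (\sum_(q : pvertex) mu (val (s p)) (val q) * 1).
  by apply: eq_bigr => q _; rewrite mulr1.
rewrite (sum_mu_pvertex idfun (fun=> 1) uN).
by apply: eq_bigr => w _; rewrite mulr1.
Qed.

(** [reach_within] with an arbitrary start state, including [None], so that induction on [n] can
    pass through the first step. At [Some p] the two are convertible. *)
Definition reach_in s x (n : nat) : rat :=
  \sum_(h : n.-tuple state | has (@in_target V A) (x :: h)) path_prob mu s x h.

Lemma path_prob_sum1 s x n : \sum_(h : n.-tuple state) path_prob mu s x h = 1.
Proof.
elim: n x => [|n IHn] x.
  by rewrite (big_pred1 [tuple]) // => h; apply/esym/eqP; rewrite [h]tuple0.
rewrite big_tuple_cons /= -[RHS](step_sum1 s x); apply: eq_bigr => y _.
by rewrite -mulr_sumr IHn mulr1.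
Qed.

Lemma reach_in_target s x n : in_target x -> reach_in s x n = 1.
Proof.
by move=> xT; rewrite /reach_in /= xT; exact: path_prob_sum1.
Qed.

Lemma reach_in0 s x : reach_in s x 0 = (in_target x)%:R.
Proof.
have [xT|xT] := boolP (in_target x); first by rewrite reach_in_target.
by rewrite /reach_in big1 // => h; rewrite tuple0 /= (negbTE xT).
Qed.

Lemma reach_inS s x n : ~~ in_target x ->
  reach_in s x n.+1 = \sum_y step mu s x y * reach_in s y n.
Proof.
move=> xT; rewrite /reach_in big_tuple_cons /=; apply: eq_bigr => y _.
by rewrite mulr_sumr /= (negbTE xT).
Qed.

Lemma reach_in_ge0 s x n : 0 <= reach_in s x n.
Proof.
rewrite /reach_in; apply: sumr_ge0 => h _.
elim: (tval h) x => //= y t IHt x; by rewrite mulr_ge0 ?step_ge0.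
Qed.

Lemma reach_in_le1 s x n : reach_in s x n <= 1.
Proof.
elim: n x => [|n IHn] x; first by rewrite reach_in0 lern1 leq_b1.
have [xT|xT] := boolP (in_target x); first by rewrite reach_in_target.
rewrite reach_inS // -(step_sum1 s x); apply: ler_sum => y _.
by rewrite ler_piMr ?step_ge0.
Qed.

Lemma reach_in_homo s x : {homo reach_in s x : n m / (n <= m)%N >-> n <= m}.
Proof.
apply: homo_leq => [//|? ? ?|n]; first exact: le_trans.
elim: n x => [|n IHn] x; (have [xT|xT] := boolP (in_target x);
  first by rewrite !reach_in_target).
  by rewrite reach_in0 (negbTE xT) reach_in_ge0.
by rewrite !reach_inS //; apply: ler_sum => y _; rewrite ler_wpM2l ?step_ge0.
Qed.

Definition reach_lim s x : R := limn (fun n => ratr (reach_in s x n) : R).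

Lemma reach_in_cvg s x : (ratr (reach_in s x n) : R) @[n --> \oo] --> reach_lim s x.
Proof.
apply: nondecreasing_is_cvgn.
  by move=> n m nm; rewrite ler_rat reach_in_homo.
exists 1 => _ [n _ <-]; by rewrite -(rmorph1 ratr) ler_rat reach_in_le1.
Qed.

Lemma reach_lim_target s x : in_target x -> reach_lim s x = 1.
Proof.
move=> xT; rewrite /reach_lim.
under eq_fun do rewrite reach_in_target // rmorph1.
exact: lim_cst.
Qed.

Lemma reach_lim_step s x : ~~ in_target x ->
  reach_lim s x = \sum_y ratr (step mu s x y) * reach_lim s y.
Proof.
move=> xT; apply: cvg_lim => //; rewrite -(cvg_shiftS _).
under eq_fun do rewrite /= reach_inS // rmorph_sum /=.
apply: cvg_big => [|y _]; first exact: add_continuous.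
under eq_fun do rewrite rmorphM /=.
by apply: cvgMr; apply: reach_in_cvg.
Qed.

Lemma reach_lim_ge0 s x : 0 <= reach_lim s x.
Proof.
apply: limr_ge; first exact: reach_in_cvg.
by apply: nearW => n; rewrite ler0q reach_in_ge0.
Qed.

(** Induction on [n] bounds every [reach_in s x n] by [h x]; the bound survives in the limit. *)
Lemma reach_lim_least s (h : state -> R) :
    (forall x, 0 <= h x) -> (forall x, in_target x -> 1 <= h x) ->
    (forall x, ~~ in_target x -> \sum_y ratr (step mu s x y) * h y <= h x) ->
  forall x, reach_lim s x <= h x.
Proof.
move=> h0 hT hstep x; apply: limr_le; first exact: reach_in_cvg.
apply: nearW => n.
elim: n x => [|n IHn] x; (have [xT|xT] := boolP (in_target x);
  first by rewrite reach_in_target // rmorph1 hT).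
  by rewrite reach_in0 (negbTE xT) rmorph0.
rewrite reach_inS // rmorph_sum /=; apply: le_trans (hstep _ xT).
apply: ler_sum => y _; rewrite rmorphM /= ler_wpM2l // ler0q.
exact: step_ge0.
Qed.

Lemma step_sumR s x : \sum_y ratr (step mu s x y) = 1 :> R.
Proof. by rewrite -rmorph_sum step_sum1 rmorph1. Qed.

Lemma stepR_ge0 s x y : 0 <= ratr (step mu s x y) :> R.
Proof. by rewrite ler0q step_ge0. Qed.

(** * Strategy improvement and simultaneous optimality *)

Lemma reach_lim_closed s (C : pred state) :
    (forall x, C x -> ~~ in_target x) ->
    (forall x y, C x -> 0 < step mu s x y -> C y) ->
  forall x, C x -> reach_lim s x = 0.
Proof.
move=> CT Cclosed x Cx; apply/eqP; rewrite eq_le reach_lim_ge0 andbT.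
(* The indicator of the complement of [C] is an admissible upper bound, and it vanishes on [C]. *)
have := @reach_lim_least s (fun x => (~~ C x)%:R) _ _ _ x.
rewrite Cx; apply=> // {x Cx} x xT.
  by case: (boolP (C x)) => // /CT; rewrite xT.
have [Cx|_] := boolP (C x); last first.
  rewrite -[leRHS](step_sumR s x); apply: ler_sum => y _.
  by rewrite ler_piMr ?stepR_ge0 // lern1 leq_b1.
rewrite big1 // => y _; have [Cy|nCy] := boolP (C y); first by rewrite mulr0.
have: ~~ (0 < step mu s x y) by apply: contra nCy; apply: Cclosed.
by rewrite lt0r step_ge0 andbT negbK => /eqP->; rewrite rmorph0 mul0r.
Qed.

Lemma reach_lim_None s : reach_lim s None = 0.
Proof.
apply: (@reach_lim_closed s (pred1 None)) => // x.
  by move=> /eqP->.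
by move=> y /eqP->; case: y => //=; rewrite ltxx.
Qed.

(* Strict improvement at [p] keeps [p] out of the argmax set [C] of
   [reach_lim s - reach_lim s'].  On [C] the two strategies agree and [C] is
   closed and misses the target, so both probabilities vanish there. *)
Lemma strategy_improvement s s' p :
    ~~ in_target (Some p) -> (forall q, q != p -> s' q = s q) ->
    reach_lim s (Some p) < \sum_y ratr (step mu s' (Some p) y) * reach_lim s y ->
  (forall x, reach_lim s x <= reach_lim s' x) /\
  reach_lim s (Some p) < reach_lim s' (Some p).
Proof.
move=> pT s'E imp.
pose g x := reach_lim s x - reach_lim s' x.
have stepE x y : x != Some p -> step mu s' x y = step mu s x y.
  by case: x => [q|] //= qp; rewrite s'E //; apply: contra qp => /eqP->.
have le_s x : ~~ in_target x ->
    reach_lim s x <= \sum_y ratr (step mu s' x y) * reach_lim s y.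
  have [->|xp] := eqVneq x (Some p) => xT; first exact: ltW.
  rewrite {1}(reach_lim_step s xT) le_eqVlt; apply/orP; left; apply/eqP.
  by apply: eq_bigr => y _; rewrite stepE.
have sumg x : ~~ in_target x -> \sum_y ratr (step mu s' x y) * g y =
    \sum_y ratr (step mu s' x y) * reach_lim s y - reach_lim s' x.
  move=> xT; rewrite (reach_lim_step s' xT) -sumrB.
  by apply: eq_bigr => y _; rewrite mulrBr.
have le_all : forall x, reach_lim s x <= reach_lim s' x.
  case: (@arg_maxP _ _ _ None predT g isT) => m _ gmax.
  have {}gmax x : g x <= g m := gmax x isT.
  suff gm : g m <= 0 by move=> x; rewrite -subr_le0; apply: le_trans gm; apply: gmax.
  rewrite leNgt; apply/negP => gm0.
  pose C := [pred x | g x == g m].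
  have CT x : C x -> ~~ in_target x.
    move=> /eqP gx; apply/negP => xT; move: gm0.
    by rewrite -gx /g !reach_lim_target // subrr ltxx.
  have avg x : C x -> g m <= \sum_y ratr (step mu s' x y) * g y.
    by move=> Cx; rewrite sumg ?CT // -(eqP Cx) /g lerB // le_s ?CT.
  have avg_le x : \sum_y ratr (step mu s' x y) * g y <= g m.
    rewrite -[leRHS]mul1r -(step_sumR s' x) mulr_suml; apply: ler_sum => y _.
    by rewrite ler_wpM2l ?stepR_ge0 //; apply: gmax.
  have Cp : ~~ C (Some p).
    apply/negP => Cx; have := avg_le (Some p); rewrite sumg // -(eqP Cx) /g.
    by rewrite lerD2r leNgt imp.
  have CE x : C x -> x != Some p by apply: contraTneq => ->.
  (* Maximum principle: no [g y] exceeds [g m], yet at [x] in [C] their average reaches [g m], so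
     every successor of positive probability attains it. *)
  have Cclosed x y : C x -> 0 < step mu s' x y -> C y.
    move=> Cx xy; rewrite /= eq_le gmax //= leNgt; apply/negP => gy.
    have := avg _ Cx; rewrite leNgt => /negP; apply.
    rewrite -[ltRHS]mul1r -(step_sumR s' x) mulr_suml.
    apply: (@ltr_sum_le _ _ _ _ y) => [z|]; last by rewrite ltr_pM2l // ltr0q.
    by rewrite ler_wpM2l ?stepR_ge0 //; apply: gmax.
  have Cm : C m by apply/eqP.
  move: gm0; rewrite /g (reach_lim_closed CT Cclosed Cm).
  rewrite (reach_lim_closed CT _ Cm) ?subrr ?ltxx // => x y Cx.
  by rewrite -stepE ?CE //; apply: Cclosed.
split=> //; rewrite (reach_lim_step s' pT); apply: lt_le_trans imp _.
by apply: ler_sum => y _; rewrite ler_wpM2l ?stepR_ge0.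
Qed.

Lemma sum_step_edge s p (h : state -> R) : h None = 0 ->
    edge A (val p) (val (s p)) ->
  \sum_y ratr (step mu s (Some p) y) * h y =
  \sum_(q : pvertex) ratr (mu (val (s p)) (val q)) * h (Some q).
Proof. by move=> h0 ps; rewrite sum_option /= ps rmorph0 mul0r add0r. Qed.

Lemma optimal_strategy (s0 : strategy) :
  exists s, forall p (u : nvertex), edge A (val p) (val u) ->
    \sum_(q : pvertex) ratr (mu (val u) (val q)) * reach_lim s (Some q)
      <= reach_lim s (Some p).
Proof.
case: (@arg_maxP _ _ _ s0 predT (fun s => \sum_x reach_lim s x) isT) => s _ smax.
exists s => p u pu; have [pT|pT] := boolP (in_target (Some p)).
  rewrite (reach_lim_target s pT).
  (* The constant strategy only rewrites the sum as a sum of step probabilities, whose total is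
     1. *)
  pose s' : strategy := [ffun=> u].
  have := @sum_step_edge s' p (reach_lim s) (reach_lim_None s).
  rewrite ffunE => /(_ pu) <-; rewrite -(step_sumR s' (Some p)).
  apply: ler_sum => y _; rewrite ler_piMr ?stepR_ge0 //.
  apply: limr_le; first exact: reach_in_cvg.
  by apply: nearW => n; rewrite -(rmorph1 ratr) ler_rat reach_in_le1.
rewrite leNgt; apply/negP => imp.
pose s' : strategy := [ffun q => if q == p then u else s q].
have s'p : s' p = u by rewrite ffunE eqxx.
have [||le_ss' lt_ss'] := @strategy_improvement s s' p pT.
- by move=> q /negbTE qp; rewrite ffunE qp.
- by rewrite sum_step_edge ?reach_lim_None ?s'p.
have := smax s' isT; rewrite /= leNgt => /negP; apply.
exact: ltr_sum_le lt_ss'.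
Qed.

End Chain.

(** * The characteristic properties of the value function *)

Section ValueFunction.
Variables (R : realType) (V : finType) (A : target_arena V).
Variable mu : V -> V -> rat.
Hypothesis mu_full : full_support A mu.

Local Notation value := (value A R mu).
Local Notation nature u := (u \notin protagonist A).

Lemma edge_to_nature p u : p \in protagonist A -> edge A p u -> nature u.
Proof. by move=> pP /edge_bipartite; rewrite pP orbF. Qed.

Lemma edge_from_nature u w : nature u -> edge A u w -> w \in protagonist A.
Proof. by move=> uN /edge_bipartite; rewrite uN (negbTE uN). Qed.

Lemma value_protagonist (p : pvertex A) : value (val p) = valueP R mu p.
Proof. by rewrite /value valK. Qed.

Lemma value_nature u : nature u ->
  value u = \sum_(w | edge A u w) ratr (mu u w) * value w.
Proof.
move=> uN; rewrite {1}/value insubF ?(negbTE uN) //; apply: eq_bigr => w uw.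
by rewrite /value (insubT (fun p => p \in _) (edge_from_nature uN uw)).
Qed.

Lemma muR_ge0 u w : nature u -> 0 <= ratr (mu u w) :> R.
Proof. by move=> uN; rewrite ler0q (mu_ge0 mu_full). Qed.

Lemma sum_muR u : nature u -> \sum_(w | edge A u w) ratr (mu u w) = 1 :> R.
Proof. by move=> /mu_full[_ _ mu1]; rewrite -rmorph_sum mu1 rmorph1. Qed.

Lemma value_least (h : V -> R) :
    (forall v, 0 <= h v) -> (forall t, t \in target A -> 1 <= h t) ->
    (forall p u, p \in protagonist A -> edge A p u -> h u <= h p) ->
    (forall u, nature u -> \sum_(w | edge A u w) ratr (mu u w) * h w <= h u) ->
  forall v, value v <= h v.
Proof.
move=> h0 hT hP hN.
have le_prot (p : pvertex A) : value (val p) <= h (val p).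
  rewrite value_protagonist; apply: bigmax_le => [|s _].
    by case: (boolP (val p \in target A)) => [/hT|].
  (* [H] extends [h] by 0 at the absorbing state, where a strategy choosing a non-edge is sent. *)
  pose H (x : state A) := if x is Some q then h (val q) else 0.
  apply: (reach_lim_least mu_full (h := H)) => [[q|]|[q|]|[q|]] //.
  - exact: h0.
  - exact: hT.
  - move=> _; have [qs|qs] := boolP (edge A (val q) (val (s q))).
      have sN := valP (s q); apply: le_trans (hP _ _ (valP q) qs).
      apply: le_trans (hN _ sN).
      by rewrite -(sum_mu_pvertex mu_full ratr h sN) (sum_step_edge mu).
    rewrite big1 => [|[y|] _ /=]; [exact: h0| |by rewrite mulr0].
    by rewrite (negbTE qs) rmorph0 mul0r.
  - by move=> _; rewrite big1 // => -[y|] _ /=; rewrite ?rmorph0 ?mul0r ?mulr0.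
move=> v; have [vP|vN] := boolP (v \in protagonist A).
  exact: (le_prot (exist _ v vP)).
rewrite value_nature //; apply: le_trans (hN _ vN); apply: ler_sum => w vw.
rewrite ler_wpM2l ?muR_ge0 //.
exact: (le_prot (exist _ w (edge_from_nature vN vw))).
Qed.

Lemma value_le1 v : value v <= 1.
Proof.
apply: (value_least (h := fun=> 1)) => // u uN.
by under eq_bigr do rewrite mulr1; rewrite sum_muR.
Qed.

Lemma value_target t : t \in target A -> value t = 1.
Proof.
move=> tT; apply/eqP; rewrite eq_le value_le1 /=.
have tP : t \in protagonist A by apply: (fintype.subsetP (target_sub A)).
rewrite -[t]/(val (exist _ t tP : pvertex A)) value_protagonist.
by apply: le_trans (bigmax_ge_id _ _ _ _); rewrite /= tT.
Qed.

Lemma value_ge0 v : 0 <= value v.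
Proof.
have ge0_prot (p : pvertex A) : 0 <= value (val p).
  rewrite value_protagonist; apply: le_trans (bigmax_ge_id _ _ _ _).
  exact: ler0n.
have [vP|vN] := boolP (v \in protagonist A); first exact: (ge0_prot (exist _ v vP)).
rewrite value_nature //; apply: sumr_ge0 => w vw.
apply: mulr_ge0; first exact: muR_ge0.
exact: (ge0_prot (exist _ w (edge_from_nature vN vw))).
Qed.

(** The inequalities of [optimal_strategy] make [reach_lim R mu s] an admissible bound in
    [reach_lim_least] for any other strategy [t], so [s] attains the maximum everywhere. The
    argument [s0] witnesses that strategies exist. *)
Lemma value_optimal (s0 : strategy A) :
  exists s, (forall p : pvertex A, value (val p) = reach_lim R mu s (Some p)) /\
    (forall (p : pvertex A) (u : nvertex A), edge A (val p) (val u) ->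
      \sum_(q : pvertex A) ratr (mu (val u) (val q)) * reach_lim R mu s (Some q)
        <= reach_lim R mu s (Some p)).
Proof.
have [s opt] := optimal_strategy R mu_full s0; exists s; split=> // p.
rewrite value_protagonist; apply/eqP; rewrite eq_le; apply/andP; split; last first.
  exact: (le_bigmax _ (fun t => reach_prob R mu t p)).
apply: bigmax_le => [|t _].
  have [pT|pT] := boolP (val p \in target A); last exact: reach_lim_ge0.
  by rewrite (reach_lim_target R mu_full).
apply: (reach_lim_least mu_full (h := reach_lim R mu s)) => [x|x xT|[q|] xT].
- exact: reach_lim_ge0.
- by rewrite (reach_lim_target R mu_full).
- have [qt|qt] := boolP (edge A (val q) (val (t q))).
    by rewrite sum_step_edge ?reach_lim_None // opt.
  rewrite sum_option reach_lim_None // mulr0 add0r big1 ?reach_lim_ge0 // => y _.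
  by rewrite /= (negbTE qt) rmorph0 mul0r.
- by rewrite (reach_lim_step R mu_full s xT).
Qed.

Lemma value_edge p u : p \in protagonist A -> edge A p u -> value u <= value p.
Proof.
move=> pP pu; have uN := edge_to_nature pP pu.
(* The endpoint [u] of the edge supplies the strategy needed to start. *)
have [s [valE opt]] := value_optimal [ffun=> exist _ u uN].
have := opt (exist _ p pP) (exist _ u uN) pu; rewrite -valE /=.
rewrite (value_nature uN) -(sum_mu_pvertex mu_full ratr value uN).
by apply: le_trans; apply: ler_sum => q _; rewrite valE.
Qed.

End ValueFunction.

(** * From a separating family to a drift partition and a path *)

Section SeparationToDrift.
Variables (R : realType) (V : finType) (A : target_arena V).
Variable mu : V -> V -> rat.
Hypothesis mu_full : full_support A mu.

Local Notation f := (value A R mu).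

(* Otherwise lowering the value on the vertices reachable from [v] inside
   [{f >= f v}] to the next smaller value gives a function which still
   satisfies the hypotheses of [value_least], but is smaller than [f] at [v]. *)
Lemma path_above_value v : 0 < f v ->
  exists pi : seq V, [/\ path (edge A) v pi, uniq (v :: pi),
    last v pi \in target A & forall x, x \in v :: pi -> f v <= f x].
Proof.
move=> fv0; pose e := [rel x y | edge A x y && (f v <= f y)].
have conn_ge x : connect e v x -> f v <= f x.
  case/connectP => p + ->; case/lastP: p => [//|p y].
  by rewrite rcons_path last_rcons => /andP[_ /andP[]].
have [/existsP[t /andP[tT /connectP[p0 p0P tE]]]|/existsPn noT] :=
    boolP [exists t, (t \in target A) && connect e v t].
  move: tE; case/shortenP: p0P => p pP p_uniq _ tE.
  exists p; split=> //; last 1 first.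
  - by move=> x xp; apply: conn_ge; apply: (path_connect pP).
  - by apply: sub_path pP => x y /andP[].
  - by rewrite -tE.
(* The default 0 covers the case that no value lies below [f v]; it is still smaller than [f v] by
   [fv0]. *)
pose c := \big[Num.max/0]_(y | f y < f v) f y.
have c0 : 0 <= c by apply: bigmax_ge_id.
have c_lt : c < f v by apply: bigmax_lt.
pose h x := if connect e v x then c else f x.
have h_le x : h x <= f x.
  by rewrite /h; case: ifP => // /conn_ge; apply: le_trans; apply: ltW.
(* A successor of a reachable vertex is either reachable itself, with [h] equal to [c], or has value
   below [f v], hence at most [c]. *)
have h_out x y : connect e v x -> edge A x y -> h y <= c.
  move=> vx xy; rewrite /h; case: ifPn => // vy.
  have fy : f y < f v.
    rewrite ltNge; apply: contra vy => fy; apply: connect_trans vx _.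
    by apply: connect1; rewrite /= xy.
  exact: (le_bigmax_cond 0 (fun y => f y)).
suff: f v <= h v by rewrite /h connect0 leNgt c_lt.
apply: (value_least mu_full).
- by move=> x; rewrite /h; case: ifP => // _; apply: value_ge0.
- move=> t tT; have := noT t; rewrite tT /= /h => /negbTE->.
  by rewrite value_target.
- move=> p u pP pu; rewrite {2}/h; case: ifPn => vp; first exact: h_out pu.
  exact: le_trans (h_le u) (value_edge R mu_full pP pu).
- move=> u uN; rewrite {2}/h; case: ifPn => vu; last first.
    rewrite (value_nature _ _ uN); apply: ler_sum => w uw.
    by rewrite ler_wpM2l ?(muR_ge0 R mu_full).
  rewrite -[leRHS]mul1r -(sum_muR R mu_full uN) mulr_suml.
  by apply: ler_sum => w uw; rewrite ler_wpM2l ?(muR_ge0 R mu_full) // (h_out u).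
Qed.

(** * Level sets of the value function below a threshold *)

Variable c : R.

Definition value_levels : seq R :=
  sort <=%R (undup [seq f x | x <- enum V & f x < c]).
Local Notation vals := value_levels.

(** [index] returns the length of the list for an absent element, so all vertices of value at least
    [c] share the top level. *)
Definition value_level (x : V) : 'I_(size vals).+1 := inord (index (f x) vals).

Definition level_set (i : 'I_(size vals).+1) : {set V} :=
  [set x | value_level x == i]%SET.
Local Notation S := level_set.

Lemma mem_value_levels x : (f x \in vals) = (f x < c).
Proof.
rewrite mem_sort mem_undup; apply/mapP/idP => [[y]|fx].
  by rewrite mem_filter => /andP[fy _] ->.
by exists x; rewrite // mem_filter fx mem_enum.
Qed.

Lemma value_levelE x : value_level x = index (f x) vals :> nat.
Proof. by rewrite inordK // ltnS index_size. Qed.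

Lemma value_level_max x : (value_level x == size vals :> nat) = (c <= f x).
Proof.
by rewrite value_levelE leNgt -mem_value_levels -index_mem ltn_neqAle index_size andbT negbK.
Qed.

Lemma value_level_lt x y : (value_level x < value_level y)%N -> f x < f y.
Proof.
move=> xy; have fx : f x < c.
  rewrite ltNge -value_level_max; apply: contraTneq xy => ->.
  by rewrite -leqNgt -ltnS.
have [fy|fy] := ltP (f y) c; last exact: lt_le_trans fy.
move: xy; rewrite !value_levelE; apply: (sorted_ltn_index lt_trans); rewrite ?mem_value_levels //.
by rewrite sort_lt_sorted undup_uniq.
Qed.

Lemma lt_value_level x y : f x < c -> f x < f y -> (value_level x < value_level y)%N.
Proof.
move=> fx fxy; rewrite ltnNge leq_eqVlt; apply/negP => /orP[/eqP yx|/value_level_lt].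
  have fyc : f y < c.
    by rewrite ltNge -value_level_max yx value_level_max -ltNge.
  have := yx; rewrite !value_levelE => /(congr1 (nth 0 vals)).
  by rewrite !nth_index ?mem_value_levels // => /eqP; rewrite gt_eqF.
by rewrite ltNge (ltW fxy).
Qed.

Lemma level_drift_partition v : c = f v -> drift_partition A S.
Proof.
move=> cE; split; first split.
(* The top level contains [v], since [c = f v]; any other level is the position of a value that is
   attained. *)
- move=> i; apply/finset.set0Pn; have [i_max|] := eqVneq (i : nat) (size vals).
    by exists v; rewrite inE -val_eqE /= i_max value_level_max cE.
  move=> i_neq; have i_lt : (i < size vals)%N.
    by rewrite ltn_neqAle i_neq leq_ord.
  have /mapP[x _ xE] : nth 0 vals i \in [seq f x | x <- enum V & f x < c].
    by rewrite -mem_undup -(mem_sort <=%R) mem_nth.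
  exists x; rewrite inE; apply/eqP/val_inj => /=.
  by rewrite value_levelE -xE index_uniq // sort_uniq undup_uniq.
- move=> i j ij; rewrite disjoint_subset; apply/fintype.subsetP => x.
  by rewrite !inE => /eqP->.
- apply/finset.setP => x; rewrite !inE; apply/finset.bigcupP.
  by exists (value_level x); rewrite ?inE.
- move=> i p u; rewrite inE => /eqP <- pP pu; apply/finset.bigcupP => -[j ij].
  rewrite inE => /eqP uj; move: ij; rewrite -uj => /value_level_lt.
  by rewrite ltNge (value_edge R mu_full pP pu).
- move=> i u w; rewrite inE => /eqP <- uN uw /finset.bigcupP[j ij].
  rewrite inE => /eqP wj; move: ij; rewrite -{}wj => uw_lev.
  have fu_lt := value_level_lt uw_lev.
  have lev_u : (value_level u < size vals)%N by apply: leq_trans uw_lev _; rewrite -ltnS.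
  have fuc : f u < c by rewrite ltNge -value_level_max neq_ltn lev_u.
  (* If no successor had a smaller value, the strictly larger value of [w] would push the average
     above [f u]. *)
  have [z uz fz] : exists2 z, edge A u z & f z < f u.
    apply/exists_inP; apply/exists_inPn => nz.
    have := value_nature R mu uN; rewrite -[LHS]mul1r -(sum_muR R mu_full uN).
    rewrite mulr_suml => /eqP; apply/negP; rewrite lt_eqF //.
    rewrite (bigD1 w) //= [ltRHS](bigD1 w) //=; apply: ltr_leD.
      rewrite ltr_pM2l // ltr0q; have [+ _ _] := mu_full uN; exact.
    apply: ler_sum => y /andP[uy _]; rewrite ler_wpM2l ?(muR_ge0 R mu_full) //.
    by rewrite leNgt nz.
  have zu : (value_level z < value_level u)%N by apply: lt_value_level => //; apply: lt_trans fuc.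
  apply/finset.bigcupP; exists (value_level u).
    by rewrite lev_u andbT; apply: leq_trans zu.
  rewrite !inE eqxx uN /=; apply/existsP; exists z; rewrite uz.
  by apply/finset.bigcupP; exists (value_level z); rewrite ?inE.
Qed.

Lemma mem_level_max x : (x \in S ord_max) = (c <= f x).
Proof. by rewrite inE -value_level_max. Qed.

Lemma mem_below_max x : (x \in below S ord_max) = (f x < c).
Proof.
rewrite ltNge -value_level_max.
have -> : (value_level x != size vals :> nat) = (value_level x < size vals)%N.
  by rewrite ltn_neqAle leq_ord andbT.
apply/finset.bigcupP/idP => [[i ik]|xk]; first by rewrite inE => /eqP->.
by exists (value_level x); rewrite ?inE.
Qed.

End SeparationToDrift.

Lemma not_never_worse_drift (R : realType) (V : finType) (A : target_arena V)
    (W : {set V}) (v : V) : W != finset.set0 -> ~ never_worse A R v W ->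
  exists (k : nat) (S : 'I_k.+1 -> {set V}) (pi : seq V),
    [/\ drift_partition A S,
        [/\ path (edge A) v pi, uniq (v :: pi) & last v pi \in target A],
        {subset v :: pi <= S ord_max},
        target A \subset S ord_max
      & W \subset below S ord_max].
Proof.
move=> /finset.set0Pn[w0 w0W] /existsNP[mu /not_implyP[mu_full /forall2NP nW]].
have lt_W w : w \in W -> value A R mu w < value A R mu v.
  by move=> wW; case: (nW w) => // /negP; rewrite ltNge.
(* Nonemptiness of [W] enters here: [v] strictly beats [w0], whose value is nonnegative. *)
have v0 : 0 < value A R mu v.
  by apply: le_lt_trans (lt_W _ w0W); apply: value_ge0.
have [pi [piP pi_uniq piT pi_ge]] := path_above_value mu_full v0.
have part := level_drift_partition mu_full (erefl (value A R mu v)).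
exists _, (@level_set R V A mu (value A R mu v)), pi; split; [exact: part|by []|..].
- by move=> x /pi_ge; rewrite mem_level_max.
- apply/fintype.subsetP => t tT; rewrite mem_level_max (value_target R mu_full tT).
  exact: value_le1.
- by apply/fintype.subsetP => w /lt_W; rewrite mem_below_max.
Qed.

(** * From a drift partition to a separating family *)

Lemma bernoulli (N : numDomainType) (e : N) (n : nat) :
  0 <= e -> e <= 1 -> 1 - n%:R * e <= (1 - e) ^+ n.
Proof.
move=> e0 e1; elim: n => [|n IHn]; first by rewrite mul0r subr0 expr0.
rewrite exprS; apply: le_trans (ler_wpM2l _ IHn); last by rewrite subr_ge0.
rewrite -natr1 -subr_ge0.
(* Multiplying the induction hypothesis by [1 - e] leaves exactly this excess. *)
rewrite [X in 0 <= X](_ : _ = n%:R * e ^+ 2); first by rewrite mulr_ge0 ?ler0n ?exprn_ge0.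
by rewrite expr2; ring.
Qed.

(** A level function turns membership in [S], [above] and [below] into comparisons of indices. *)
Lemma partition_level (V : finType) (k : nat) (S : 'I_k.+1 -> {set V}) :
  Defs.indexed_partition S ->
  exists l : V -> 'I_k.+1, forall x i, (x \in S i) = (l x == i).
Proof.
move=> [_ disj /finset.setP cov].
have /fin_all_exists[l lP] x : exists i, x \in S i.
  by move: (cov x); rewrite inE => /finset.bigcupP[i _ xi]; exists i.
exists l => x i; apply/idP/eqP => [xi|<- //]; apply/eqP/negPn/negP => /disj.
by move=> /disjointFr/(_ (lP x)); rewrite xi.
Qed.

Section DriftToSeparation.
Variables (R : realType) (V : finType) (A : target_arena V).
Variables (k : nat) (S : 'I_k.+1 -> {set V}) (l : V -> 'I_k.+1).
Hypothesis S_drift : drift_partition A S.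
Hypothesis lP : forall x i, (x \in S i) = (l x == i).
Hypothesis targetS : target A \subset S ord_max.

Lemma mem_above x i : (x \in above S i) = (i < l x)%N.
Proof.
apply/finset.bigcupP/idP => [[j ij]|ix]; first by rewrite lP => /eqP->.
by exists (l x); rewrite ?lP.
Qed.

Lemma mem_below x i : (x \in below S i) = (l x < i)%N.
Proof.
apply/finset.bigcupP/idP => [[j ij]|ix]; first by rewrite lP => /eqP->.
by exists (l x); rewrite ?lP.
Qed.

Lemma protagonist_level p u : p \in protagonist A -> edge A p u ->
  (l u <= l p)%N.
Proof.
move=> pP pu; have [_ /(_ (l p) p u) + _] := S_drift.
by rewrite lP eqxx mem_above -leqNgt; apply.
Qed.

Lemma nature_level u w : u \notin protagonist A -> edge A u w ->
  (l u < l w)%N ->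
  (l u < k)%N /\ exists2 z, edge A u z & (l z < l u)%N.
Proof.
move=> uN uw luw; have [_ _ /(_ (l u) u w)] := S_drift.
rewrite lP eqxx mem_above => /(_ isT uN uw luw) /finset.bigcupP[i /andP[_ ik]].
rewrite inE lP => /andP[/eqP lu /andP[_ /existsP[z /andP[uz]]]].
by rewrite mem_below -lu => lz; split; [rewrite lu|exists z].
Qed.

Variables (d : V -> V) (e : rat).
Hypotheses (e_gt0 : 0 < e) (e_lt1 : e < 1).
Hypothesis d_edge : forall u, u \notin protagonist A -> edge A u (d u).
Hypothesis d_below : forall u, u \notin protagonist A -> (l u < k)%N ->
  (exists2 z, edge A u z & (l z < l u)%N) -> (l (d u) < l u)%N.

(** The preferred successor [d u] gets weight at least [1 - e]; the remaining mass [e] is spread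
    uniformly over all successors to keep full support. *)
Definition biased (u w : V) : rat :=
  if edge A u w then (1 - e) * (w == d u)%:R + e / #|edge A u|%:R else 0.

Lemma degree_gt0 u : u \notin protagonist A -> (0 < #|edge A u|)%N.
Proof. by move=> uN; apply/card_gt0P; exists (d u); apply: d_edge. Qed.

Lemma sum_biased (N : comPzRingType) (g : {rmorphism rat -> N}) (F : V -> N) u :
    u \notin protagonist A ->
  \sum_(w | edge A u w) g (biased u w) * F w =
  (1 - g e) * F (d u) + \sum_(w | edge A u w) g (e / #|edge A u|%:R) * F w.
Proof.
move=> uN; under eq_bigr => w uw.
  by rewrite /biased uw rmorphD rmorphM rmorphB rmorph1 rmorph_nat /= mulrDl; over.
rewrite big_split /=; congr (_ + _).
rewrite (bigD1 (d u)) ?d_edge //= eqxx mulr1 big1 ?addr0 // => w /andP[_ /negbTE->].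
by rewrite mulr0 mul0r.
Qed.

Lemma sum_uniform u : u \notin protagonist A ->
  \sum_(w | edge A u w) e / #|edge A u|%:R = e.
Proof.
move=> uN; rewrite sumr_const -[LHS]mulr_natr divfK // pnatr_eq0 -lt0n.
exact: degree_gt0.
Qed.

Lemma biased_full : full_support A biased.
Proof.
move=> u uN; split=> [w uw|w /negbTE uw|].
- rewrite /biased uw ltr_wpDl // ?mulr_ge0 ?ler0n ?subr_ge0 ?(ltW e_lt1) //.
  by rewrite divr_gt0 // ltr0n degree_gt0.
- by rewrite /biased uw.
- transitivity (\sum_(w | edge A u w) biased u w * 1).
    by apply: eq_bigr => w _; rewrite mulr1.
  rewrite (sum_biased idfun (fun=> 1)) //=.
  under eq_bigr do rewrite mulr1; by rewrite sum_uniform // mulr1 subrK.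
Qed.

Local Notation f := (value A R biased).
Local Notation eR := (ratr e : R).

Let eR_gt0 : 0 < eR. Proof. by rewrite ltr0q. Qed.
Let eR_lt1 : eR < 1. Proof. by rewrite -(rmorph1 ratr) ltr_rat. Qed.
Let eRC_ge0 n : 0 <= (1 - eR) ^+ n.
Proof. by rewrite exprn_ge0 // subr_ge0 ltW. Qed.
Let eRC_le1 n : (1 - eR) ^+ n <= 1.
Proof. by apply: exprn_ile1; rewrite ?subr_ge0 ?gerBl ltW. Qed.

(* [1 - (1 - e) ^ i] solves [h i = (1 - e) h (i - 1) + e]: a drift vertex of
   level [i] moves down with probability at least [1 - e] and otherwise has
   value at most [1]. *)
Definition climb_bound (x : V) : R :=
  if (l x < k)%N then 1 - (1 - eR) ^+ l x else 1.

Lemma climb_bound_ge0 x : 0 <= climb_bound x.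
Proof. by rewrite /climb_bound; case: ifP => // _; rewrite subr_ge0. Qed.

Lemma climb_bound_le1 x : climb_bound x <= 1.
Proof. by rewrite /climb_bound; case: ifP => // _; rewrite gerBl. Qed.

Lemma climb_bound_homo x y : (l x <= l y)%N -> climb_bound x <= climb_bound y.
Proof.
move=> xy; rewrite {2}/climb_bound; case: ifPn => [yk|_]; last exact: climb_bound_le1.
rewrite /climb_bound (leq_ltn_trans xy yk) lerB // ler_wiXn2l //.
  by rewrite subr_ge0 ltW.
by rewrite gerBl ltW.
Qed.

Lemma value_le_climb_bound x : f x <= climb_bound x.
Proof.
apply: (value_least biased_full) => [v|t tT|p u pP pu|u uN].
- exact: climb_bound_ge0.
- move/fintype.subsetP: targetS => /(_ _ tT); rewrite lP /climb_bound => /eqP->.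
  by rewrite ltnn.
- exact: climb_bound_homo (protagonist_level pP pu).
(* Without a higher successor, monotonicity of the bound suffices. Otherwise [u] is a drift vertex,
   so [d u] lies strictly lower. *)
have [/exists_inP[w uw luw]|/exists_inPn lev_le] :=
    boolP [exists (w | edge A u w), (l u < l w)%N]; last first.
  rewrite -[leRHS]mul1r -(sum_muR R biased_full uN) mulr_suml.
  apply: ler_sum => w uw; rewrite ler_wpM2l ?(muR_ge0 R biased_full) //.
  by apply: climb_bound_homo; rewrite leqNgt lev_le.
have [uk down] := nature_level uN uw luw; have ldu := d_below uN uk down.
rewrite sum_biased //.
(* The predecessor is harmless: [d u] lies below [u], so [l u] is positive. *)
have -> : climb_bound u = (1 - eR) * (1 - (1 - eR) ^+ (l u).-1) + eR.
  rewrite /climb_bound uk; case: (nat_of_ord (l u)) ldu => // n _.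
  by rewrite exprS /=; ring.
apply: lerD; last first.
  rewrite -[leRHS](congr1 ratr (sum_uniform uN)) rmorph_sum /=.
  apply: ler_sum => z _; rewrite ler_piMr ?climb_bound_le1 //.
  by rewrite ler0q divr_ge0 ?ler0n // ltW.
rewrite ler_wpM2l ?subr_ge0 ?(ltW eR_lt1) // /climb_bound (ltn_trans ldu uk).
rewrite lerB // ler_wiXn2l ?subr_ge0 ?gerBl ?(ltW eR_lt1) ?(ltW eR_gt0) //.
by rewrite -ltnS prednK //; apply: leq_ltn_trans ldu.
Qed.

(** Going back along the path, a protagonist edge costs nothing and an edge out of a vertex of V_N
    costs a factor [1 - e]. *)
Lemma value_ge_path v pi :
    path [rel x y | edge A x y && ((x \notin protagonist A) ==> (d x == y))] v pi ->
    last v pi \in target A ->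
  (1 - eR) ^+ size pi <= f v.
Proof.
elim: pi v => [|y pi IHpi] v /=.
  by move=> _ vT; rewrite (value_target R biased_full).
move=> /andP[/andP[vy dv] piP] piT; have fy := IHpi y piP piT.
have [vP|vN] := boolP (v \in protagonist A).
  apply: le_trans (value_edge R biased_full vP vy); apply: le_trans fy.
  by rewrite exprS ler_piMl // gerBl ltW.
move: dv; rewrite vN /= => /eqP dv.
rewrite value_nature // sum_biased // dv exprS ler_wpDr //.
  apply: sumr_ge0 => w _; apply: mulr_ge0; last exact: (value_ge0 R biased_full).
  by rewrite ler0q divr_ge0 ?ler0n // ltW.
by rewrite ler_wpM2l // subr_ge0 ltW.
Qed.

End DriftToSeparation.

(** * Choice of the preferred successors and of the bias *)

Lemma drift_not_never_worse (R : realType) (V : finType) (A : target_arena V)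
    (W : {set V}) (v : V) (k : nat) (S : 'I_k.+1 -> {set V}) (pi : seq V) :
    drift_partition A S -> path (edge A) v pi -> uniq (v :: pi) ->
    last v pi \in target A -> {subset v :: pi <= S ord_max} ->
    target A \subset S ord_max -> W \subset below S ord_max -> W != finset.set0 ->
  ~ never_worse A R v W.
Proof.
move=> S_drift piP pi_uniq piT piS TS /fintype.subsetP WS /finset.set0Pn[w0 w0W].
have [part _ _] := S_drift; have [l lP] := partition_level part.
(* As the path is simple, a vertex determines its successor on it. The two demands in [succ_ok]
   cannot conflict: the first concerns levels below [k], the second only level [k]. *)
pose nx := next (v :: pi).
pose succ_ok u w := [&& edge A u w,
  ((l u < k)%N && [exists z, edge A u z && (l z < l u)%N]) ==> (l w < l u)%N &
  ((l u == ord_max) && edge A u (nx u)) ==> (w == nx u)].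
have /fin_all_exists[d dP] u : exists w, u \notin protagonist A -> succ_ok u w.
  have [uP|/nature_succ[y0 uy0]] := boolP (u \in protagonist A).
    by exists u.
  have [lu|] := eqVneq (l u) ord_max.
    rewrite /succ_ok lu /= ltnn /=.
    have [uw|uw] := boolP (edge A u (nx u)).
      by exists (nx u) => _; rewrite uw !eqxx.
    by exists y0 => _; rewrite uy0 andbF.
  move=> lu; rewrite /succ_ok (negbTE lu) /=.
  have [/existsP[z /andP[uz luz]]|no] := boolP [exists z, edge A u z && (l z < l u)%N].
    by exists z => _; rewrite uz luz implybT.
  by exists y0 => _; rewrite uy0 andbF.
(* This gives [(size pi + k) * e = 1 - e], which is less than 1. That [e < 1] needs [0 < k], which
   follows from [w0] lying below the top level. *)
pose e : rat := ((size pi + k).+1%:R)^-1.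
have e_gt0 : 0 < e by rewrite invr_gt0 ltr0n.
have lW w : w \in W -> (l w < k)%N by move=> /WS; rewrite (mem_below lP).
have e_lt1 : e < 1.
  rewrite invf_lt1 ?ltr0n // ltr1n ltnS addn_gt0 orbC.
  by rewrite (leq_ltn_trans (leq0n _) (lW _ w0W)).
have d_edge u : u \notin protagonist A -> edge A u (d u).
  by move=> /dP/and3P[].
have d_below u : u \notin protagonist A -> (l u < k)%N ->
    (exists2 z, edge A u z & (l z < l u)%N) -> (l (d u) < l u)%N.
  move=> /dP/and3P[_ /implyP + _] => + uk [z uz luz]; apply; rewrite uk.
  by apply/existsP; exists z; rewrite uz.
have d_path : path [rel x y | edge A x y && ((x \notin protagonist A) ==> (d x == y))] v pi.
  (* [next] reads [v :: pi] as a cycle; the closing step back to [v] is discarded. *)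
  have := cycle_next pi_uniq; rewrite -/nx /= rcons_path => /andP[nextP _].
  have allS : all [in S ord_max] (v :: pi) by apply/allP.
  have : path [rel x y | edge A x y && frel nx x y] v pi by rewrite path_relI piP.
  apply: (sub_in_path (P := [in S ord_max])) allS => x y xS _ /andP[xy /eqP nxt].
  rewrite /= xy; apply/implyP => /dP/and3P[_ _ /implyP]; rewrite nxt xy.
  by move: xS; rewrite lP => ->; apply.
move=> /(_ _ (biased_full e_gt0 e_lt1 d_edge))[w wW].
apply/negP; rewrite -ltNge.
have := value_ge_path R e_gt0 e_lt1 d_edge d_path piT.
apply: lt_le_trans.
have := value_le_climb_bound R S_drift lP TS e_gt0 e_lt1 d_edge d_below w.
move=> /le_lt_trans; apply; rewrite /climb_bound (lW _ wW).
set r : R := ratr e.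
have r_gt0 : 0 < r by rewrite ltr0q.
have r_le1 : r <= 1 by rewrite -(rmorph1 ratr) ler_rat ltW.
have rE : (size pi)%:R * r + k%:R * r + r = 1.
  rewrite -mulrDl -natrD -[X in _ + X]mul1r -mulrDl natr1.
  by rewrite /r /e fmorphV /= rmorph_nat mulfV // pnatr_eq0.
(* The chain is [1 - (1 - r) ^+ l w <= l w * r <= k * r < 1 - size pi * r <= (1 - r) ^+ size pi];
   the strict step is [rE] with [0 < r]. *)
have := bernoulli (size pi) (ltW r_gt0) r_le1.
have := bernoulli (l w) (ltW r_gt0) r_le1.
have : (l w)%:R * r <= k%:R * r by rewrite ler_wpM2r ?(ltW r_gt0) // ler_nat ltnW ?lW.
lra.
Qed.

(* [target A \subset S ord_max] holds automatically when T has at most one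
   element; with two or more targets (ii) does not imply (i) without it. *)
Theorem theorem3 (R : realType) (V : finType) (A : target_arena V)
    (W : {set V}) (v : V) (hW : W != finset.set0) :
  ~ never_worse A R v W <->
  exists (k : nat) (S : 'I_k.+1 -> {set V}) (pi : seq V),
    [/\ drift_partition A S,
        [/\ path (edge A) v pi, uniq (v :: pi) & last v pi \in target A],
        {subset v :: pi <= S ord_max},
        target A \subset S ord_max
      & W \subset below S ord_max].
Proof.
split; first exact: not_never_worse_drift.
move=> [k [S [pi [S_drift [piP pi_uniq piT] piS TS WS]]]].
exact: drift_not_never_worse S_drift piP pi_uniq piT piS TS WS hW.
Qed.
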